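(* Let $t$ be an arbitrary positive integer and let $n,k$ be positive integers with $n\ge k^2$. There exists a sufficiently small universal constant $\delta>0$ (independent of $t,k,n$) such that the $\delta$-error randomized one-way communication complexity of the Augmented Sparse Set-Disjointness problem with parameters $t,k,n$ is $\Omega(tk\log k)$.
   Context: Augmented Sparse Set-Disjointness: Alice receives sets $A_1,\dots,A_t\subseteq[n]$ and Bob receives sets $B_1,\dots,B_t\subseteq[n]$, with $|A_j|=|B_j|=k$ for all $j$. Bob additionally receives an index $j\in[t]$ and the sets $A_1,\dots,A_{j-1}$. Alice sends a single message $M$ to Bob (the parties share a public random string), and Bob must output whether $A_j\cap B_j=\emptyset$. A protocol has $\delta$ error if on every input Bob answers correctly with probability at least $1-\delta$; the $\delta$-error complexity is the minimum over such protocols of the maximum message length in bits. *)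

(* Defs.v *)
From HB Require Import structures.
From mathcomp Require Import all_boot all_order all_algebra.
From mathcomp Require Import reals exp.

Set Implicit Arguments.
Unset Strict Implicit.
Unset Printing Implicit Defensive.

Import Order.TTheory GRing.Theory Num.Theory.
Local Open Scope ring_scope.

(* The public random string is drawn from an arbitrary distribution on a finite
   set.  Bob's last two arguments before the output are the index j and the
   list A_1, ..., A_{j-1}; his output [true] means "A_j and B_j are disjoint".
   Indices j and elements of [n] are numbered from 0. *)
Record protocol (R : realType) (t n : nat) := Protocol {
  coins : finType;
  weight : coins -> R;
  weight_ge0 : forall w, 0 <= weight w;
  weight_sum1 : \sum_w weight w = 1;
  alice : coins -> t.-tuple {set 'I_n} -> seq bool;
  bob : coins -> seq bool -> t.-tuple {set 'I_n} -> 'I_t ->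
        seq {set 'I_n} -> bool
}.

Definition k_sparse (t n k : nat) (A : t.-tuple {set 'I_n}) : bool :=
  all (fun S : {set 'I_n} => #|S| == k) A.

Definition correct (R : realType) (t n : nat) (P : protocol R t n)
    (A B : t.-tuple {set 'I_n}) (j : 'I_t) (w : coins P) : bool :=
  bob w (alice w A) B j (take j A) == [disjoint tnth A j & tnth B j].

Definition has_error (R : realType) (t n k : nat) (delta : R)
    (P : protocol R t n) : Prop :=
  forall (A B : t.-tuple {set 'I_n}) (j : 'I_t),
    k_sparse k A -> k_sparse k B ->
    1 - delta <= \sum_(w : coins P | correct A B j w) weight w.

Definition max_length (R : realType) (t n k : nat) (P : protocol R t n) : nat :=
  (\max_(w : coins P) \max_(A : t.-tuple {set 'I_n} | k_sparse k A)
     size (alice w A))%N.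

(* The minimum is attained whenever [0 <= delta], as Alice may send her whole
   input. *)
Definition is_complexity (R : realType) (t n k : nat) (delta : R) (m : nat)
    : Prop :=
  (exists2 P : protocol R t n, has_error k delta P & max_length k P = m) /\
  (forall P : protocol R t n, has_error k delta P -> (m <= max_length k P)%N).

(* Main.v *)
(* Write k = r + 1.  Place a k x k grid of cells inside [n].  Alice encodes r
   symbols of an alphabet of size k, one per row, plus the first cell of the
   last row as padding; Bob's query (i, S) consists of the cells of S in row i,
   padded to size k with cells of the last row that avoid Alice's.  The answers
   to all queries (i, S) determine the i-th symbol robustly, since the answer
   vectors of two symbols differ on half of the S.  So from the message and
   A_1, ..., A_{j-1} each symbol of A_j is recovered with error at most 4 delta.
   Decoding A_1, ..., A_t in turn shows that a given message is compatible with
   few inputs having few decoding errors; weighing each input by lam^(errors),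
   with lam = k^-2, gives #messages >= k^(t r / 4). *)
Require Import Defs.
From HB Require Import structures.
From mathcomp Require Import all_boot all_order all_algebra.
From mathcomp Require Import reals exp.
From mathcomp Require Import perm boolp sequences ring lra.

Import Order.TTheory GRing.Theory Num.Theory.
Local Open Scope ring_scope.

(** * Counting inputs by weighted decoding errors *)

(** Induction on the first entry: once it is fixed, the remaining factors form a family of the same
    kind, with that entry put in front of every prefix. *)
Lemma sum_tuple_prefix (R : comNzRingType) (T : finType) (C : R) (t : nat)
    (F : 'I_t -> seq T -> T -> R) :
  (forall j s, \sum_y F j s y = C) ->
  \sum_(x : t.-tuple T) \prod_(j < t) F j (take j x) (tnth x j) = C ^+ t.
Proof.
elim: t F => [|t IHt] F sumF.
  rewrite (big_pred1 [tuple]) ?big_ord0 ?expr0 // => x.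
  by apply/esym/eqP; apply: tuple0.
pose c (p : T * t.-tuple T) : t.+1.-tuple T := [tuple of p.1 :: p.2].
have c_bij : bijective c.
  exists (fun x => (thead x, behead_tuple x)).
    by case=> y x; congr pair; apply/val_inj.
  by move=> x; rewrite /c /= [RHS]tuple_eta.
rewrite (reindex c) /=; last exact: onW_bij.
rewrite -(pair_big predT predT (fun y x =>
  \prod_(j < t.+1) F j (take j (c (y, x))) (tnth (c (y, x)) j))) /=.
transitivity (\sum_y F ord0 [::] y * C ^+ t); last first.
  by rewrite -mulr_suml sumF exprS.
apply: eq_bigr => y _.
rewrite -(IHt (fun j s => F (lift ord0 j) (y :: s))); last by move=> j s.
rewrite mulr_sumr; apply: eq_bigr => x _.
by rewrite big_ord_recl; congr (_ * _); apply: eq_bigr => j _; rewrite tnthS.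
Qed.

(** In each coordinate the symbol [d i] contributes 1 and each of the others contributes [lam]. *)
Lemma sum_ffun_errors (R : comNzRingType) (T : finType) (r : nat) (lam : R)
    (d : 'I_r -> T) :
  \sum_(y : {ffun 'I_r -> T}) \prod_i lam ^+ (d i != y i)
    = (1 + (#|T|.-1)%:R * lam) ^+ r.
Proof.
rewrite -(bigA_distr_bigA (fun i y => lam ^+ (d i != y))) /=.
rewrite -[r in RHS]card_ord -prodr_const; apply: eq_bigr => i _.
rewrite (bigD1 (d i)) //= eqxx expr0; congr (_ + _).
under eq_bigr => y yd do rewrite eq_sym yd expr1.
rewrite sumr_const mulr_natl; congr (_ *+ _).
by rewrite -(cardC1 (d i)); apply: eq_card => y.
Qed.

(** Replacing the term at [M x] by the sum over all messages only adds nonnegative terms. For a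
    fixed message the decoder at [j] sees just the entries before [j], so the sum over inputs
    factors. *)
Lemma sum_errors_le (R : realType) (T Msg : finType) (t r : nat) (lam : R)
    (M : t.-tuple {ffun 'I_r -> T} -> Msg)
    (dec : Msg -> 'I_t -> seq {ffun 'I_r -> T} -> 'I_r -> T) :
  0 <= lam ->
  \sum_(x : t.-tuple {ffun 'I_r -> T})
     lam ^+ (\sum_j \sum_i (dec (M x) j (take j x) i != tnth x j i))
   <= (#|Msg|)%:R * (1 + (#|T|.-1)%:R * lam) ^+ (r * t).
Proof.
move=> lam0; pose e m (x : t.-tuple {ffun 'I_r -> T}) : nat :=
  (\sum_j \sum_i (dec m j (take j x) i != tnth x j i))%N.
apply: (@le_trans _ _ (\sum_x \sum_m lam ^+ e m x)).
  apply: ler_sum => x _; rewrite (bigD1 (M x)) //= lerDl.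
  by apply: sumr_ge0 => m _; apply: exprn_ge0.
rewrite exchange_big /= mulr_natl -sumr_const; apply: ler_sum => m _.
rewrite exprM -(@sum_tuple_prefix _ _ _ t
  (fun j s y => \prod_i lam ^+ (dec m j s i != y i))); last first.
  by move=> j s; rewrite sum_ffun_errors.
rewrite le_eqVlt; apply/orP; left; apply/eqP/eq_bigr => x _.
rewrite expr_sum.
by apply: eq_bigr => j _; rewrite expr_sum.
Qed.

(* Convexity of the exponential, through its tangent at the value [a]. *)
Lemma sum_expr_ge (R : realType) (X : finType) (lam a : R) (e : X -> nat) :
  0 < lam <= 1 -> (\sum_x e x)%:R <= a * (#|X|)%:R ->
  (#|X|)%:R * expR (a * ln lam) <= \sum_x lam ^+ e x.
Proof.
move=> /andP[lam0 lam1] ea.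
have ln0 : ln lam <= 0 by apply: ln_le0.
apply: (@le_trans _ _
  (\sum_x expR (a * ln lam) * (1 + ((e x)%:R - a) * ln lam))).
  rewrite -mulr_sumr mulrC ler_wpM2l ?expR_ge0 // big_split /= -mulr_suml.
  rewrite sumr_const lerDl sumrB -natr_sum sumr_const.
  by apply: (mulr_le0 _ ln0); rewrite subr_le0 -[a *+ _]mulr_natr.
apply: ler_sum => x _.
rewrite -[lam in leRHS]lnK ?posrE // -expRM_natl.
have -> : (e x)%:R * ln lam = a * ln lam + ((e x)%:R - a) * ln lam by ring.
by rewrite expRD ler_wpM2l ?expR_ge0 // expR_ge1Dx.
Qed.

(** With [N = t * r], an average of at most [N / 8] errors makes the weighted sum at least
    [q ^ N * lam ^ (N / 8) = q ^ (3N / 4)], against at most [#|Msg| * (5 / 4) ^ N]. As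
    [(5 / 4) ^ 2 <= 2 <= q], a factor [q ^ (N / 4)] is left for the messages. *)
Lemma ln_card_messages (R : realType) (T Msg : finType) (t r : nat)
    (M : t.-tuple {ffun 'I_r -> T} -> Msg)
    (dec : Msg -> 'I_t -> seq {ffun 'I_r -> T} -> 'I_r -> T) :
  (1 < #|T|)%N ->
  (8 * \sum_(x : t.-tuple {ffun 'I_r -> T})
         \sum_j \sum_i (dec (M x) j (take j x) i != tnth x j i)
    <= t * r * #|{: t.-tuple {ffun 'I_r -> T}}|)%N ->
  (t * r)%:R * ln (#|T|)%:R / 4 <= ln (#|Msg|)%:R :> R.
Proof.
(* Equivalent to [(q - 2) ^ 2 >= 0] after clearing denominators. *)
have factor (q : R) : 2 <= q -> 1 + (q - 1) * (q ^+ 2)^-1 <= 5 / 4.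
  move=> q2; suff : (q - 1) / q ^+ 2 <= 4^-1 by lra.
  by rewrite ler_pdivrMr ?exprn_gt0 //; nra.
have final (N lnq lnm lnb : R) : 0 <= N -> 2 * lnb <= lnq ->
    N * lnq + N / 8 * - (2 * lnq) <= lnm + N * lnb -> N * lnq / 4 <= lnm.
  by move=> N0 b lnmain; nra.
have lnpow (x : R) m : 0 < x -> m%:R * ln x = ln (x ^+ m).
  by move=> x0; rewrite lnXn // mulr_natl.
have b0 : (0 : R) < 5 / 4 by lra.
have b2 : (5 / 4) ^+ 2 <= 2 :> R by lra.
set q := #|T|; set X := t.-tuple _; set N := (t * r)%N => q1.
pose e (x : X) : nat :=
  (\sum_j \sum_i (dec (M x) j (take j x) i != tnth x j i))%N.
rewrite -[(\sum_x _)%N]/(\sum_x e x)%N => err.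
have q0 : (0 : R) < q%:R by rewrite ltr0n ltnW.
have q2 : (2 : R) <= q%:R by rewrite ler_nat.
pose lam : R := (q%:R ^+ 2)^-1.
have lam0 : 0 < lam by rewrite invr_gt0 exprn_gt0.
have lam1 : lam <= 1 by rewrite invf_le1 ?exprn_gt0 // expr_ge1 ?ler1n ?(ltnW q1).
have lnlam : ln lam = - (2 * ln q%:R).
  by rewrite lnV ?posrE ?exprn_gt0 // lnXn // mulr_natl.
have lam5 : 1 + (q.-1)%:R * lam <= 5 / 4.
  by rewrite -subn1 natrB ?(ltnW q1) //; apply: factor.
have lower := @sum_expr_ge R X lam (N%:R / 8) e.
have upper := @sum_errors_le R T Msg t r lam M dec (ltW lam0).
have cardX : #|{: X}| = (q ^ N)%N.
  by rewrite card_tuple card_ffun card_ord -/q -expnM mulnC.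
have main : q%:R ^+ N * expR (N%:R / 8 * ln lam)
    <= (#|Msg|)%:R * (5 / 4) ^+ N.
  apply: (@le_trans _ _ (\sum_(x : X) lam ^+ e x)).
    rewrite -natrX -cardX; apply: lower; first by rewrite lam0.
    rewrite mulrAC ler_pdivlMr // -!natrM ler_nat mulnC; exact: err.
  apply: (le_trans upper); rewrite ler_wpM2l // mulnC lerXn2r ?nnegrE //.
  - by rewrite addr_ge0 // mulr_ge0 // ltW.
  - exact: ltW.
have msg0 : 0 < (#|Msg|)%:R :> R.
  rewrite ltr0n lt0n; apply: contraTneq main => ->; rewrite mul0r -ltNge.
  by rewrite mulr_gt0 ?expR_gt0 ?exprn_gt0.
have lnmain : N%:R * ln q%:R + N%:R / 8 * ln lam
    <= ln (#|Msg|)%:R + N%:R * ln (5 / 4).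
  rewrite -(expRK (N%:R / 8 * ln lam)) !lnpow // -!lnM
    ?posrE ?expR_gt0 ?exprn_gt0 //.
  by rewrite ler_ln ?posrE ?mulr_gt0 ?expR_gt0 ?exprn_gt0.
have ln54 : 2 * ln (5 / 4) <= ln q%:R :> R.
  rewrite lnpow // ler_ln ?posrE ?exprn_gt0 //.
  exact: le_trans q2.
by apply: final ln54 _; rewrite // -lnlam.
Qed.

(** * Recovering a symbol from membership answers *)

(* Only nonempty [S] give a query; for [S = set0] the set built by Bob below
   consists of the cells of the last row, which always meets Alice's set. *)
Definition answer {K : finType} (y : K) (S : {set K}) : bool :=
  (S != set0) && (y \notin S).

(** Nearest-codeword decoding for the code that sends [y] to the vector of all [answer y S]. *)
Definition decode {K : finType} (y0 : K) (f : {set K} -> bool) : K :=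
  [arg min_(y < y0) (\sum_S (f S != answer y S))%N].

(** Toggling [x] in [S] changes the truth of [x \in S] but not of [y \in S], so exactly one of [S]
    and [tog S] separates the two symbols. The exception at [set0] is harmless, since neither symbol
    belongs to it. *)
Lemma answer_separation (K : finType) (x y : K) : x != y ->
  (2 * \sum_S (answer x S != answer y S) = #|{set K}|)%N.
Proof.
move=> xy; pose tog (S : {set K}) := if x \in S then S :\ x else x |: S.
have togK : involutive tog.
  move=> S; rewrite /tog; case: (boolP (x \in S)) => xS.
    by rewrite setD11 setD1K.
  by rewrite setU11 setU1K.
have sepE S : (answer x S != answer y S) = ((x \in S) != (y \in S)).
  rewrite /answer; case: (eqVneq S set0) => [->|_]; first by rewrite !inE.
  by case: (x \in S); case: (y \in S).
rewrite mul2n -addnn [X in (X + _)%N](reindex_inj (inv_inj togK)) -big_split /=.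
rewrite -sum1_card; apply: eq_bigr => S _; rewrite !sepE /tog.
case: (boolP (x \in S)) => xS; rewrite !inE eqxx [y == x]eq_sym (negPf xy) /=;
  by case: (y \in S).
Qed.

(** Triangle inequality: a wrongly decoded [y] is at least as close to [f] as [x] is, and the
    codewords of [x] and [y] differ on half of the sets, so [f] differs from that of [x] on at least
    a quarter. *)
Lemma decode_error (K : finType) (y0 x : K) (f : {set K} -> bool) :
  ((decode y0 f != x) * #|{set K}| <= 4 * \sum_S (f S != answer x S))%N.
Proof.
case: (boolP (decode y0 f != x)) => [|_]; last by rewrite mul0n.
rewrite /decode; case: arg_minnP => // y _ /(_ x isT) min_y yx.
rewrite mul1n -(answer_separation _ y x yx).
rewrite (_ : 4 = 2 * 2)%N // -mulnA leq_pmul2l // mul2n -addnn.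
apply: leq_trans (leq_add min_y (leqnn _)); rewrite -big_split /=.
apply: leq_sum => S _.
by case: (f S); case: (answer x S); case: (answer y S).
Qed.

(** * The hard sets on the grid *)

Definition alice_set {E : finType} {r : nat} (cell : 'I_r.+1 * 'I_r.+1 -> E)
    (x : {ffun 'I_r -> 'I_r.+1}) : {set E} :=
  [set cell (i, if unlift ord_max i is Some i' then x i' else ord0)
     | i : 'I_r.+1].

(** Alice's padding sits in column [ord0] of the last row. The transposition swaps [ord0] with an
    element of [S], so no [y] outside a nonempty [S] lands there, and injectivity is kept. For empty
    [S] it is the identity. *)
Definition bob_cell {r : nat} (i : 'I_r) (S : {set 'I_r.+1}) (y : 'I_r.+1)
    : 'I_r.+1 * 'I_r.+1 :=
  if y \in S then (lift ord_max i, y)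
  else (ord_max, tperm ord0 (odflt ord0 [pick z in S]) y).

Definition bob_set {E : finType} {r : nat} (cell : 'I_r.+1 * 'I_r.+1 -> E)
    (i : 'I_r) (S : {set 'I_r.+1}) : {set E} :=
  [set cell (bob_cell i S y) | y : 'I_r.+1].

Lemma card_alice_set (E : finType) (r : nat) (cell : 'I_r.+1 * 'I_r.+1 -> E)
    (x : {ffun 'I_r -> 'I_r.+1}) :
  injective cell -> #|alice_set cell x| = r.+1.
Proof.
by move=> cell_inj; rewrite card_imset ?card_ord // => i j /cell_inj[].
Qed.

Lemma card_bob_set (E : finType) (r : nat) (cell : 'I_r.+1 * 'I_r.+1 -> E)
    (i : 'I_r) (S : {set 'I_r.+1}) :
  injective cell -> #|bob_set cell i S| = r.+1.
Proof.
move=> cell_inj; rewrite card_imset ?card_ord // => y z /cell_inj yz.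
move: (congr1 fst yz) (congr1 snd yz); rewrite /bob_cell.
case: ifP => _; case: ifP => _ //= /eqP; last by move=> _ /perm_inj.
- by rewrite eq_sym (negPf (neq_lift _ _)).
- by rewrite (negPf (neq_lift _ _)).
Qed.

Lemma disjoint_alice_bob (E : finType) (r : nat)
    (cell : 'I_r.+1 * 'I_r.+1 -> E) (x : {ffun 'I_r -> 'I_r.+1})
    (i : 'I_r) (S : {set 'I_r.+1}) :
  injective cell ->
  [disjoint alice_set cell x & bob_set cell i S] = answer (x i) S.
Proof.
move=> cell_inj; apply/idP/idP; rewrite /answer.
  move=> dis; apply/andP; split.
    apply: contraTneq dis => ->; apply/pred0Pn; exists (cell (ord_max, ord0)).
    apply/andP; split; apply/imsetP.
      by exists ord_max => //; rewrite unlift_none.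
    exists ord0 => //; rewrite /bob_cell inE; case: pickP => [z|_] /=.
      by rewrite inE.
    by rewrite tperm1 perm1.
  apply: contraTN dis => xS; apply/pred0Pn; exists (cell (lift ord_max i, x i)).
  apply/andP; split; apply/imsetP.
    by exists (lift ord_max i) => //; rewrite liftK.
  by exists (x i) => //; rewrite /bob_cell xS.
move=> /andP[S0 xS]; apply/pred0Pn => -[z /andP[/imsetP[a _ ->]]].
case/imsetP => y _ /cell_inj; rewrite /bob_cell.
case: ifP => yS [-> ].
  by rewrite liftK => xy; rewrite xy yS in xS.
rewrite unlift_none; case: pickP => [u uS|S00]; last first.
  by case/set0Pn: S0 => v; rewrite S00.
(* Hitting Alice's padding cell would force [y = u], but [u] is in [S] and [y] is not. *)
by rewrite -[LHS](tpermR ord0 u) => /perm_inj uy; rewrite -uy uS in yS.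
Qed.

(** * Averaging over the public coins *)

Lemma exists_le_mean (R : realDomainType) (W : finType) (p f : W -> R) (a : R) :
  (forall w, 0 <= p w) -> \sum_w p w = 1 -> \sum_w p w * f w <= a ->
  exists w, f w <= a.
Proof.
move=> p0 p1 mean; apply/existsP/contraT => /existsPn far.
have gap w : 0 <= p w * (f w - a).
  by rewrite mulr_ge0 // subr_ge0 ltW // ltNge.
have : \sum_w p w * (f w - a) == 0.
  rewrite eq_le sumr_ge0 // andbT.
  under eq_bigr do rewrite mulrBr.
  by rewrite sumrB -mulr_suml p1 mul1r subr_le0.
rewrite psumr_eq0 // => /allP null.
move: p1; rewrite big1 => [/eqP|w _]; first by rewrite eq_sym oner_eq0.
have := null w (mem_index_enum w).
rewrite mulf_eq0 subr_eq0 => /orP[/eqP //|/eqP fa].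
by have := far w; rewrite fa lexx.
Qed.

Section HardInputs.
Context {R : realType} {t n r : nat} (P : protocol R t n).
Context (cell : 'I_r.+1 * 'I_r.+1 -> 'I_n).
Hypothesis cell_inj : injective cell.
Hypothesis P_err : has_error r.+1 (32^-1) P.

Definition hard_input (x : t.-tuple {ffun 'I_r -> 'I_r.+1}) :
    t.-tuple {set 'I_n} := map_tuple (alice_set cell) x.

(** Repeating one set in every position lets the same tuple serve all indices [j]. *)
Definition query (i : 'I_r) (S : {set 'I_r.+1}) : t.-tuple {set 'I_n} :=
  nseq_tuple t (bob_set cell i S).

(** The message does not depend on Bob's input, so a single [m] can be reused for the queries of all
    [S]; the earlier sets are rebuilt from the earlier symbols [s]. *)
Definition guess (w : coins P) (m : seq bool) (j : 'I_t)
    (s : seq {ffun 'I_r -> 'I_r.+1}) (i : 'I_r) : 'I_r.+1 :=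
  decode ord0 (fun S => bob w m (query i S) j (map (alice_set cell) s)).

Lemma hard_input_sparse x : k_sparse r.+1 (hard_input x).
Proof.
by apply/allP => S /mapP[y _ ->]; rewrite card_alice_set.
Qed.

Lemma query_sparse i S : k_sparse r.+1 (query i S).
Proof.
by apply/allP => B /nseqP[-> _]; rewrite card_bob_set.
Qed.

(** Each query fails with probability at most 1/32, so by linearity the expected fraction of wrong
    answers is at most 1/32; [decode_error] costs a factor 4. *)
Lemma guess_error (x : t.-tuple {ffun 'I_r -> 'I_r.+1}) (j : 'I_t) (i : 'I_r) :
  \sum_w weight w *
     (guess w (alice w (hard_input x)) j (take j x) i != tnth x j i)%:R
    <= 8^-1.
Proof.
pose wrong S (w : coins P) := ~~ correct (hard_input x) (query i S) j w.
have wrongP S : \sum_w weight w * (wrong S w)%:R <= 32^-1.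
  have := P_err _ _ j (hard_input_sparse x) (query_sparse i S).
  rewrite lerBlDr -lerBlDl; apply: le_trans.
  rewrite -[1 in leRHS](weight_sum1 P).
  rewrite [X in _ <= X - _](bigID
    (fun w => correct (hard_input x) (query i S) j w)).
  rewrite addrAC subrr add0r [leRHS]big_mkcond; apply: ler_sum => w _ /=.
  by rewrite /wrong; case: ifP => _; rewrite ?mulr1 ?mulr0.
have card0 : 0 < #|{set 'I_r.+1}|%:R :> R.
  by rewrite ltr0n; apply/card_gt0P; exists set0.
rewrite -(ler_pM2r card0) mulr_suml.
apply: (@le_trans _ _ (\sum_w weight w * (4 * \sum_S (wrong S w)%:R))).
  apply: ler_sum => w _; rewrite -mulrA ler_wpM2l ?weight_ge0 //.
  rewrite -natr_sum -!natrM ler_nat.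
  apply: leq_trans (decode_error _ _ _ _) _; rewrite leq_pmul2l //.
  apply: leq_sum => S _; rewrite /wrong /correct.
  by rewrite !tnth_map tnth_nseq disjoint_alice_bob //= map_take.
under eq_bigr => w _ do rewrite mulrCA mulr_sumr.
rewrite -mulr_sumr exchange_big /=.
apply: (@le_trans _ _ (4 * \sum_(S : {set 'I_r.+1}) 32^-1)).
  by rewrite ler_wpM2l // ler_sum.
rewrite sumr_const -[32^-1 *+ _]mulr_natr mulrA ler_wpM2r //.
by lra.
Qed.

(** The easy direction of Yao's principle: the error bound, averaged over uniform [x], must be met
    by some fixed coin outcome, which makes the protocol deterministic. *)
Lemma exists_good_coins :
  exists w, (8 * \sum_(x : t.-tuple {ffun 'I_r -> 'I_r.+1}) \sum_j \sum_i
       (guess w (alice w (hard_input x)) j (take j x) i != tnth x j i)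
    <= t * r * #|{: t.-tuple {ffun 'I_r -> 'I_r.+1}}|)%N.
Proof.
pose err w (x : t.-tuple {ffun 'I_r -> 'I_r.+1}) j i : nat :=
  guess w (alice w (hard_input x)) j (take j x) i != tnth x j i.
pose N := (t * r * #|{: t.-tuple {ffun 'I_r -> 'I_r.+1}}|)%N.
have [|w] := @exists_le_mean R (coins P) (@weight _ _ _ P)
    (fun w => (\sum_x \sum_j \sum_i err w x j i)%:R) (8^-1 * N%:R)
    (@weight_ge0 _ _ _ P) (weight_sum1 P).
  under eq_bigr => w _.
    rewrite natr_sum mulr_sumr.
    under eq_bigr => x _.
      rewrite natr_sum mulr_sumr.
      under eq_bigr => j _ do rewrite natr_sum mulr_sumr.
      over.
    over.
  rewrite exchange_big /=.
  apply: (@le_trans _ _ (\sum_(x : t.-tuple {ffun 'I_r -> 'I_r.+1})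
     \sum_(j < t) \sum_(i < r) 8^-1)).
    apply: ler_sum => x _; rewrite exchange_big; apply: ler_sum => j _.
    by rewrite exchange_big; apply: ler_sum => i _; apply: guess_error.
  rewrite !sumr_const !card_ord -!mulrnA mulr_natr /N.
  by rewrite mulnCA mulnA.
rewrite mulrC ler_pdivlMr // -natrM ler_nat mulnC => good.
by exists w.
Qed.

Lemma ln_card_bseq_ge : (0 < r)%N ->
  (t * r)%:R * ln (r.+1)%:R / 4
    <= ln (#|{: (max_length r.+1 P).-bseq bool}|)%:R :> R.
Proof.
move=> r0; have [w good] := exists_good_coins.
set L := max_length _ _.
(* The default of [insub_bseq] is never taken: hard inputs are sparse, so their messages have length
   at most [L]. *)
pose M x : L.-bseq bool := insub_bseq L (alice w (hard_input x)).
have ME x : M x = alice w (hard_input x) :> seq bool.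
  rewrite /M /insub_bseq val_insubd ifT // /L /max_length.
  apply: leq_trans (leq_bigmax w).
  by apply: (leq_bigmax_cond (hard_input x)); apply: hard_input_sparse.
have := @ln_card_messages R 'I_r.+1 _ t r M (fun m => guess w m).
rewrite card_ord; apply=> //.
apply: leq_trans good; rewrite leq_pmul2l //; apply/eq_leq/eq_bigr => x _.
by rewrite ME.
Qed.

End HardInputs.

(** * From the number of messages to their length *)

Lemma ln_card_bseq_le (R : realType) (L : nat) :
  ln (#|{: L.-bseq bool}|)%:R <= (2 * L)%:R :> R.
Proof.
(* The case of length 0 is separate: there the logarithm is exactly 0, while the cruder bound by
   length plus one would exceed the claim. *)
rewrite card_bseq card_bool; case: L => [|L].
  by rewrite big_ord1 ln1.
have le2 : (\sum_(i < L.+2) 2 ^ i <= 2 ^ L.+2)%N.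
  by rewrite -[X in (X <= _)%N]mul1n -(predn_exp 2) leq_pred.
apply: (@le_trans _ _ (ln (2 ^+ L.+2))).
  rewrite ler_ln ?posrE ?exprn_gt0 // -?natrX ?ler_nat //.
  by rewrite ltr0n big_ord_recl.
rewrite lnXn // -[leLHS]mulr_natl.
apply: (@le_trans _ _ (L.+2)%:R); last first.
  by rewrite ler_nat mul2n -addnn addnS ltnS leq_addr.
rewrite ler_piMr //; have := @le_ln1Dx R 1; rewrite -[1 + 1]/(2%:R); apply.
by lra.
Qed.

(** The constant 1/16 collects 1/4 from the count of messages, 1/2 from [ln_card_bseq_le] and 1/2
    from [k <= 2 * (k - 1)]. For [k = 1] the logarithm vanishes. *)
Lemma max_length_ge (R : realType) (t n k : nat) (P : protocol R t n) :
  (0 < k)%N -> (k ^ 2 <= n)%N -> has_error k (32^-1) P ->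
  16^-1 * (t%:R * k%:R * ln k%:R) <= (max_length k P)%:R :> R.
Proof.
case: k => // -[|r] _ kn P_err; first by rewrite ln1 !mulr0.
have card_cells : (#|{: 'I_r.+2 * 'I_r.+2}| <= n)%N.
  by rewrite card_prod card_ord.
(* Here [k ^ 2 <= n] makes room for the grid inside ['I_n]. *)
pose cell (p : 'I_r.+2 * 'I_r.+2) := widen_ord card_cells (enum_rank p).
have cell_inj : injective cell.
  move=> p q /(congr1 (@nat_of_ord n)) /= pq.
  by apply: enum_rank_inj; apply: val_inj.
have ge := @ln_card_bseq_ge R t n r.+1 P cell cell_inj P_err isT.
have le := @ln_card_bseq_le R (max_length r.+2 P).
have := le_trans ge le; rewrite !natrM.
have r2 : (r.+2)%:R <= 2 * (r.+1)%:R :> R.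
  by rewrite -natrM ler_nat mul2n -addnn addnS ltnS leq_addr.
have t0 : 0 <= t%:R * ln (r.+2)%:R :> R by rewrite mulr_ge0 ?ln_ge0 ?ler1n.
have := ler_wpM2r t0 r2.
move: (ln _) (max_length _ _)%:R => l m; lra.
Qed.

(** * Existence of the complexity *)

(** Alice sends the rank of her input in unary. The message is long, but any valid protocol suffices
    for the minimum to exist. *)
Lemma exists_exact_protocol (R : realType) (t n k : nat) (delta : R) :
  0 <= delta -> exists P : protocol R t n, has_error k delta P.
Proof.
move=> delta0.
pose a (_ : unit) (A : t.-tuple {set 'I_n}) := nseq (enum_rank A) true.
pose b (_ : unit) (m : seq bool) (B : t.-tuple {set 'I_n}) (j : 'I_t)
    (_ : seq {set 'I_n}) : bool :=
  [disjoint tnth (nth B (enum {: t.-tuple {set 'I_n}}) (size m)) j & tnth B j].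
have w1 : \sum_(w : unit) (1 : R) = 1 by rewrite sumr_const card_unit.
exists (@Protocol R t n unit (fun=> 1) (fun=> ler01) w1 a b) => A B j _ _.
rewrite (eq_bigl predT) /= => [|w]; last first.
  by rewrite /correct /= /a /b size_nseq nth_enum_rank eqxx.
by rewrite w1 lerBlDr lerDl.
Qed.

Lemma exists_complexity (R : realType) (t n k : nat) (delta : R) :
  0 <= delta -> exists m, is_complexity t n k delta m.
Proof.
move=> /(exists_exact_protocol R t n k)[P0 P0_err].
pose p m := `[< exists2 P : protocol R t n,
                  has_error k delta P & max_length k P = m >].
have ex_p : exists m, p m by exists (max_length k P0); apply/asboolP; exists P0.
case: (ex_minnP ex_p) => m /asboolP pm min_m; exists m; split=> // P P_err.
by apply: min_m; apply/asboolP; exists P.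
Qed.

Theorem theorem8p4 (R : realType) :
  exists delta : R, 0 < delta /\
  exists c : R, 0 < c /\
  forall t n k : nat, (0 < t)%N -> (0 < n)%N -> (0 < k)%N -> (k ^ 2 <= n)%N ->
  exists m : nat, is_complexity t n k delta m /\
    c * (t%:R * k%:R * ln k%:R) <= m%:R.
Proof.
exists 32^-1; split; first by rewrite invr_gt0.
exists 16^-1; split; first by rewrite invr_gt0.
move=> t n k _ _ k0 kn.
have [|m m_min] := exists_complexity R t n k (32^-1); first by rewrite invr_ge0.
exists m; split=> //; case: m_min => -[P P_err <-] _.
exact: max_length_ge.
Qed.
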